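(* Let $a,b$ be relatively prime positive integers and let $P$ be an $(a,b)$-Dyck path. Then the partitions $\lambda(P)$ and $\mu(P)$ can be computed as follows: (i) The parts of $\lambda(P)$ (with multiplicity, $a$ parts including zeros) are the sums of the laser fillings of $P$ in the $a$ rows of the grid. (ii) The parts of $\mu(P)$ (with multiplicity, $b$ parts including zeros) are the sums of the laser fillings of $P$ in the $b$ columns of the grid.
   Context: An $(a,b)$-Dyck path is a lattice path from $(0,0)$ to $(b,a)$ with unit north steps and unit east steps, all of whose lattice points $(x,y)$ satisfy $ax\le by$; it is drawn in the grid with $a$ rows and $b$ columns. Hooks and cores: the unit box with southeast corner $(x,y)$ has hook filling $by-ax$. The positive hooks of $P$ are the positive hook fillings of the boxes of the grid lying below (southeast of) $P$. $\mathfrak{c}(P)$ is the partition whose set of first-column hook lengths is the set of positive hooks of $P$ (it is an $(a,b)$-core, i.e. has no hook length equal to $a$ or $b$). For a partition $\kappa$ and a positive integer $m$: consider the hook lengths of the boxes in the first column of $\kappa$; for each residue modulo $m$ that occurs take the largest such hook length; the rows of $\kappa$ with these first-column hook lengths are the $m$-rows. The $m$-boundary of $\kappa$ is the set of boxes with hook length less than $m$. $\lambda(P)=(\lambda_1\ge\dots\ge\lambda_a)$ has as parts the numbers of $b$-boundary boxes in the $a$-rows of $\mathfrak{c}(P)$ (padded with zeros), and $\mu(P)=(\mu_1\ge\dots\ge\mu_b)$ has as parts the numbers of $a$-boundary boxes in the $b$-rows of $\mathfrak{c}(P)$ (padded with zeros). Laser filling: let $B$ be a box of the grid below $P$ and above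 the line $y=\frac ab x$ (i.e. a box below $P$ with positive hook). Draw the full line (laser) of slope $\frac ab$ through the southeast corner of $B$. The laser filling of $B$ is the number of vertical walls (north steps) of $P$ crossed by this line; equivalently, the number of horizontal walls (east steps) of $P$ crossed by it. Boxes that are not both below $P$ and above the line $y=\frac ab x$ carry no filling (contribute zero to the sums). *)

(* Defs.v *)
From mathcomp Require Import all_boot all_order all_algebra.
From mathcomp Require Import zify.

Import Order.TTheory GRing.Theory Num.Theory.

Set Implicit Arguments.
Unset Strict Implicit.
Unset Printing Implicit Defensive.

(** * Integer partitions, hook lengths *)

Definition is_partition (kappa : seq nat) : bool :=
  sorted geq kappa && (0 \notin kappa).

(* Rows and columns are numbered from 0; the box (i, j) belongs to the diagram
   when i < size kappa and j < nth 0 kappa i, and the hook length is only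
   meaningful for such boxes (the subtractions are then exact). *)
Definition arm (kappa : seq nat) (i j : nat) : nat := nth 0 kappa i - j.+1.

Definition leg (kappa : seq nat) (i j : nat) : nat :=
  count (fun p => j < p) kappa - i.+1.

Definition hook_length (kappa : seq nat) (i j : nat) : nat :=
  (arm kappa i j + leg kappa i j).+1.

Definition first_column_hooks (kappa : seq nat) : seq nat :=
  [seq hook_length kappa i 0 | i <- iota 0 (size kappa)].

Definition is_special_row (m : nat) (kappa : seq nat) (i : nat) : bool :=
  all (fun k => (hook_length kappa k 0 == hook_length kappa i 0 %[mod m]) ==>
                (hook_length kappa k 0 <= hook_length kappa i 0))
      (iota 0 (size kappa)).

(* The m-rows: in each residue class mod m that occurs among the first-column
   hook lengths, the row with the largest one. *)
Definition special_rows (m : nat) (kappa : seq nat) : seq nat :=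
  [seq i <- iota 0 (size kappa) | is_special_row m kappa i].

Definition boundary_in_row (m : nat) (kappa : seq nat) (i : nat) : nat :=
  count (fun j => hook_length kappa i j < m) (iota 0 (nth 0 kappa i)).

(* The numbers of n-boundary boxes in the m-rows, padded with zeros to m parts
   and listed in weakly decreasing order. *)
Definition boundary_partition (m n : nat) (kappa : seq nat) : seq nat :=
  let parts := [seq boundary_in_row n kappa i | i <- special_rows m kappa] in
  sort geq (parts ++ nseq (m - size parts) 0).

(* If kappa has k rows and first-column hook lengths h_0 > ... > h_(k-1), then
   h_i = kappa_i + (k - 1 - i). *)
Definition partition_of_hooks (H : seq nat) : seq nat :=
  let s := sort geq (undup H) in
  [seq nth 0 s i - (size s - i.+1) | i <- iota 0 (size s)].

(** * Dyck paths *)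

(* A lattice path from (0,0) is its sequence of unit steps: true is a north
   step, false an east step.  [path_point P k] is the lattice point (x, y)
   reached after k steps. *)
Definition path_point (P : seq bool) (k : nat) : nat * nat :=
  (count_mem false (take k P), count_mem true (take k P)).

Definition path_points (P : seq bool) : seq (nat * nat) :=
  [seq path_point P k | k <- iota 0 (size P).+1].

Definition dyck_path (a b : nat) (P : seq bool) : bool :=
  (path_point P (size P) == (b, a)) &&
  all (fun p => a * p.1 <= b * p.2) (path_points P).

(* by - ax: constant on the lines of slope a/b, increasing towards the
   north-west. *)
Definition level (a b : nat) (p : nat * nat) : int :=
  (b%:Z * p.2%:Z - a%:Z * p.1%:Z)%R.

(* A unit box is designated by its southeast corner (x, y); those of the grid
   have 1 <= x <= b and 0 <= y < a.  It is below P when its northwest corner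
   (x - 1, y + 1) lies weakly southeast of a lattice point of P. *)
Definition below (P : seq bool) (x y : nat) : bool :=
  has (fun p => (p.1 < x) && (y < p.2)) (path_points P).

Definition positive_hook_boxes (a b : nat) (P : seq bool) : seq (nat * nat) :=
  [seq c <- [seq (x, y) | x <- iota 1 b, y <- iota 0 a]
     | below P c.1 c.2 && (0 < level a b c)%R].

Definition positive_hooks (a b : nat) (P : seq bool) : seq nat :=
  [seq `|level a b c|%N | c <- positive_hook_boxes a b P].

Definition core_of_path (a b : nat) (P : seq bool) : seq nat :=
  partition_of_hooks (positive_hooks a b P).

Definition lambda_partition (a b : nat) (P : seq bool) : seq nat :=
  boundary_partition a b (core_of_path a b P).

Definition mu_partition (a b : nat) (P : seq bool) : seq nat :=
  boundary_partition b a (core_of_path a b P).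

(** * Laser fillings *)

(* The line of slope a/b through c crosses the k-th step of P, a north step,
   when the two endpoints of that step lie on opposite sides of the line; on a
   north step the level increases. *)
Definition laser_crosses (a b : nat) (P : seq bool) (c : nat * nat) (k : nat)
    : bool :=
  nth false P k &&
  (level a b (path_point P k) < level a b c < level a b (path_point P k.+1))%R.

Definition laser_filling (a b : nat) (P : seq bool) (x y : nat) : nat :=
  if below P x y && (0 < level a b (x, y))%R
  then count (laser_crosses a b P (x, y)) (iota 0 (size P))
  else 0.

(** * [core_of_path] is the partition with the prescribed first column *)

Lemma first_column_hooksE kappa i : is_partition kappa -> i < size kappa ->
  hook_length kappa i 0 = nth 0 kappa i + (size kappa - i.+1).
Proof.
case/andP=> _ k0 ik; rewrite /hook_length /arm /leg.
have -> : count (fun p => 0 < p) kappa = size kappa.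
  apply/eqP; rewrite -all_count; apply/allP => p pk.
  by case: p pk k0 => // ->.
have : 0 < nth 0 kappa i.
  by rewrite lt0n; apply: contraNneq k0 => <-; exact: mem_nth.
lia.
Qed.

Lemma sorted_first_column_hooks kappa :
  is_partition kappa -> sorted gtn (first_column_hooks kappa).
Proof.
move=> pk; apply/(sortedP 0) => i; rewrite size_map size_iota => ik.
rewrite !(nth_map 0) ?size_iota ?nth_iota ?add0n ?(ltnW ik) //.
rewrite !first_column_hooksE ?(ltnW ik) //.
case/andP: pk => /(sortedP 0)/(_ i ik) /= + _; lia.
Qed.

Lemma first_column_hooks_inj kappa kappa' :
  is_partition kappa -> is_partition kappa' ->
  first_column_hooks kappa =i first_column_hooks kappa' -> kappa = kappa'.
Proof.
move=> pk pk' eqm.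
have e : first_column_hooks kappa = first_column_hooks kappa'.
  apply: (@irr_sorted_eq _ gtn) => //; try exact: sorted_first_column_hooks.
    by move=> y x z /= xy yz; exact: ltn_trans yz xy.
  by move=> x /=; rewrite ltnn.
have es : size kappa = size kappa'.
  by have := congr1 size e; rewrite !size_map !size_iota.
apply: (@eq_from_nth _ 0) => // i ik.
have := congr1 (nth 0 ^~ i) e.
rewrite !(nth_map 0) ?size_iota ?nth_iota ?add0n -?es //.
rewrite !first_column_hooksE -?es //; lia.
Qed.

Lemma partition_of_hooksP (H : seq nat) : 0 \notin H ->
  is_partition (partition_of_hooks H) /\
  first_column_hooks (partition_of_hooks H) =i H.
Proof.
move=> H0; rewrite /partition_of_hooks; set s := sort geq (undup H).
have ms : s =i H by move=> x; rewrite mem_sort mem_undup.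
have us : uniq s by rewrite sort_uniq undup_uniq.
have ss : forall i, i.+1 < size s -> nth 0 s i.+1 < nth 0 s i.
  move=> i ik; have : sorted geq s.
    by apply: sort_sorted => x y /=; exact: leq_total.
  move=> /(sortedP 0)/(_ i ik) /=; rewrite leq_eqVlt => /predU1P[|//].
  by move/eqP; rewrite nth_uniq ?(ltnW ik) // gtn_eqF.
have lb : forall d i, i + d.+1 = size s -> d < nth 0 s i.
  elim=> [|d IH] i id.
    have ik : i < size s by rewrite -id addn1.
    by rewrite lt0n; apply: contraNneq H0 => <-; rewrite -ms mem_nth.
  have i1k : i.+1 < size s by rewrite -id; lia.
  have := IH i.+1; have := ss i i1k; rewrite -id; lia.
set kappa := map _ _.
have sk : size kappa = size s by rewrite size_map size_iota.
have nk i : i < size s -> nth 0 kappa i = nth 0 s i - (size s - i.+1).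
  by move=> ik; rewrite (nth_map 0) ?size_iota // nth_iota.
have pk : is_partition kappa.
  apply/andP; split.
    apply/(sortedP 0) => i; rewrite sk => ik /=; rewrite !nk ?(ltnW ik) //.
    have := ss i ik; lia.
  apply/negP => /(nthP 0)[i]; rewrite sk => ik; rewrite nk //.
  have := lb (size s - i.+1) i; lia.
split=> // x; rewrite -ms; congr (x \in _).
apply: (@eq_from_nth _ 0); rewrite size_map size_iota sk // => i ik.
rewrite (nth_map 0) ?size_iota ?nth_iota ?sk // add0n.
rewrite first_column_hooksE ?sk // nk //.
have := lb (size s - i.+1) i; lia.
Qed.

Lemma core_of_pathP (a b : nat) (P : seq bool) :
  is_partition (core_of_path a b P) /\
  first_column_hooks (core_of_path a b P) =i positive_hooks a b P.
Proof.
apply: partition_of_hooksP; apply/mapP => -[c].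
rewrite mem_filter => /andP[/andP[_ c0] _] /esym/eqP.
by rewrite absz_eq0 gt_eqF.
Qed.

(* Main.v *)
Require Import Defs.
From mathcomp Require Import all_boot all_algebra.
From mathcomp Require Import zify.

(** Both parts are one counting identity about a set of natural numbers.  Let
    [H] be the set of positive hooks of the path, and call the natural numbers
    outside [H] gaps.  In a row of the core with first-column hook length [h],
    the hook lengths are the differences [h - g] over the gaps [g < h]
    ([perm_row_gaps]).  Hence its number of boundary boxes for the bound [n] is
    the number of gaps at distance less than [n] below [h]
    ([boundary_in_rowE]).

    Levels by - ax drop by [a] from a box to its right neighbour and by [b] from
    a box to the one below it.  So [H] is closed under subtracting [a] as long as
    the result is positive, and in each residue class mod [a] the gaps are the
    numbers f, f + a, f + 2a, ... above a lowest gap f.  This f is the level of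
    the start of the north step in the grid row carrying that class, because the
    box just right of this step has level f - a and is the leftmost box of the
    row below the path ([lowest_gaps_north]).  In particular the a-rows of the
    core have first-column hook lengths f - a, for those f with f >= a.
    Likewise, mod [b], the lowest gaps are the levels of the ends of the east
    steps, one for each grid column ([lowest_gaps_east]).

    The positive boxes of the row of f below the path have levels
    c = f - a - ia.  The laser through such a box crosses the north step starting
    at level f' exactly when f' < c < f' + b, that is, when the gap g = f' + ia
    satisfies g < f - a < g + b.  Each gap is f' + ia for a unique pair (f', i),
    so the laser fillings of the row add up to the number of gaps at distance
    less than [b] below f - a, which is the required part ([gaps_nearE],
    [laser_row_sum]).

    For columns the same computation needs the crossed east steps.  The path
    starts and ends at level 0, below the laser, and none of its points lies on
    the laser, so it crosses the laser upwards as often as downwards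
    ([crossings_balance], [laser_avoids_path]). *)

Set Implicit Arguments.
Unset Strict Implicit.
Unset Printing Implicit Defensive.

Definition gaps_near (n : nat) (H : seq nat) (h : nat) : nat :=
  count (fun g => (g \notin H) && (h - g < n)) (iota 0 h).

(** [H] as an abacus with [m] runners: the family [f], indexed
    by [I], gives on each runner the first position not occupied by [H], and [H]
    fills every runner from the bottom up to there.  The index list makes it
    possible to number grid rows from 0 and grid columns from 1. *)
Definition lowest_gaps (m : nat) (I : seq nat) (f : nat -> nat) (H : seq nat)
    : Prop :=
  [/\ 0 < m, size I = m, uniq [seq f k %% m | k <- I] &
      forall h, (h \in H) = has (fun k => (h < f k) && (h == f k %[mod m])) I].

(** * Hook lengths in a row of a partition *)

Section Partitions.

Variable kappa : seq nat.
Hypothesis pk : is_partition kappa.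

Lemma nth_partition_anti i j : i <= j -> nth 0 kappa j <= nth 0 kappa i.
Proof.
move=> ij; have [jk|kj] := ltnP j (size kappa); last by rewrite nth_default.
case/andP: pk => /(sorted_leq_nth (rev_trans leq_trans) leqnn 0) + _.
by apply=> //; rewrite inE //; exact: leq_ltn_trans jk.
Qed.

(** The columns of the diagram are read off the same boxes as its rows; this is
    what lets leg lengths be compared with parts. *)
Lemma conjugate_gt i j :
  i < size kappa -> (i < count (fun p => j < p) kappa) = (j < nth 0 kappa i).
Proof.
move=> ik; have split := cat_take_drop i kappa.
have dropE : drop i kappa = nth 0 kappa i :: drop i.+1 kappa.
  exact: drop_nth.
have [ji|ij] := ltnP j (nth 0 kappa i).
  rewrite -split count_cat dropE /= ji.
  have -> : count (fun p => j < p) (take i kappa) = i.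
    apply/eqP; rewrite -{2}(size_takel (ltnW ik)) -all_count.
    apply/(all_nthP 0) => l; rewrite (size_takel (ltnW ik)) => li.
    by rewrite nth_take // (leq_trans ji) // nth_partition_anti // ltnW.
  by rewrite addnA addn1 ltnS leq_addr.
rewrite -split count_cat.
have -> : count (fun p => j < p) (drop i kappa) = 0.
  apply/eqP; rewrite -leqn0 leqNgt -has_count; apply/hasPn => p.
  case/(nthP 0) => l _ <-; rewrite nth_drop -leqNgt.
  by rewrite (leq_trans _ ij) // nth_partition_anti // leq_addr.
rewrite addn0 ltnNge; apply/negbTE/negPn.
by rewrite (leq_trans (count_size _ _)) // size_takel // ltnW.
Qed.

Lemma nth_first_column_hooks i : i < size kappa ->
  nth 0 (first_column_hooks kappa) i = hook_length kappa i 0.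
Proof. by move=> ik; rewrite (nth_map 0) ?size_iota ?nth_iota. Qed.

Lemma size_first_column_hooks : size (first_column_hooks kappa) = size kappa.
Proof. by rewrite size_map size_iota. Qed.

Lemma uniq_first_column_hooks : uniq (first_column_hooks kappa).
Proof.
apply: (@sorted_uniq _ gtn) (sorted_first_column_hooks pk).
- by move=> y x z /= xy yz; exact: ltn_trans yz xy.
- by move=> x; exact: ltnn.
Qed.

(** The function maps the box in row [i] and column [j] to the difference between
    the first hook length of the row and the hook length of the box.  That number
    is [j] plus the number of rows too short to meet column [j], so it does not
    depend on [i] and increases strictly with [j].  It is no first-column hook
    length: equality with that of row [l] would force the part [l] and the column
    height [j] to sum to [j + l + 1], whereas the sum is at least [j + l + 2] if
    the box in row [l] and column [j] exists and at most [j + l] otherwise.  A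
    count of the gaps below the hook length of row [i] shows that none is
    missed. *)
Lemma perm_row_gaps i : i < size kappa ->
  perm_eq [seq j + (size kappa - count (fun p => j < p) kappa)
             | j <- iota 0 (nth 0 kappa i)]
          [seq g <- iota 0 (hook_length kappa i 0)
             | g \notin first_column_hooks kappa].
Proof.
move=> ik; set gap := fun j => _; set H := first_column_hooks kappa.
have cle j : count (fun p => j < p) kappa <= size kappa by exact: count_size.
have gap_mono j j' : j < j' -> gap j < gap j'.
  move=> jj'; rewrite /gap.
  have : count (fun p => j' < p) kappa <= count (fun p => j < p) kappa.
    by apply: sub_count => p /=; lia.
  have := cle j; have := cle j'; lia.
have gap_inj : injective gap.
  by move=> j j' e; case: (ltngtP j j') => // /gap_mono; rewrite e ltnn.
have ug : uniq (map gap (iota 0 (nth 0 kappa i))).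
  by rewrite map_inj_uniq ?iota_uniq.
have sub : {subset map gap (iota 0 (nth 0 kappa i)) <=
            [seq g <- iota 0 (hook_length kappa i 0) | g \notin H]}.
  move=> g /mapP[j + ->]; rewrite mem_iota add0n => ji.
  rewrite mem_filter mem_iota add0n; apply/andP; split; last first.
    rewrite first_column_hooksE // /gap.
    have := conjugate_gt j ik; have := cle j; lia.
  apply/negP => /(nthP 0)[l]; rewrite size_first_column_hooks => lk.
  rewrite nth_first_column_hooks // first_column_hooksE // /gap.
  have := conjugate_gt j lk; have := cle j; lia.
(* The rows below [i] contribute enough elements of [H] below its hook length. *)
have szle : size [seq g <- iota 0 (hook_length kappa i 0) | g \notin H]
            <= nth 0 kappa i.
  rewrite size_filter -(leq_add2l (count (mem H) (iota 0 (hook_length kappa i 0)))).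
  rewrite (count_predC (mem H)) size_iota.
  rewrite {1}first_column_hooksE // addnC leq_add2r -size_filter.
  rewrite -size_first_column_hooks -/H -size_drop.
  apply: uniq_leq_size; first by rewrite drop_uniq // uniq_first_column_hooks.
  move=> h hd; rewrite mem_filter mem_iota add0n.
  apply/andP; split; first exact: mem_drop hd.
  case/(nthP 0): hd => l; rewrite size_drop size_first_column_hooks => lk <-.
  have ilk : i.+1 + l < size kappa by lia.
  rewrite nth_drop nth_first_column_hooks // !first_column_hooksE //.
  have : nth 0 kappa (i.+1 + l) <= nth 0 kappa i.
    by apply: nth_partition_anti; lia.
  lia.
have [|_ eqg] := uniq_min_size ug sub; first by rewrite size_map size_iota.
by apply: uniq_perm => //; rewrite filter_uniq // iota_uniq.
Qed.

Lemma boundary_in_rowE n i : i < size kappa ->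
  boundary_in_row n kappa i =
  gaps_near n (first_column_hooks kappa) (hook_length kappa i 0).
Proof.
move=> ik; rewrite /gaps_near.
rewrite (eq_count (a2 := predI (fun g => hook_length kappa i 0 - g < n)
  (fun g => g \notin first_column_hooks kappa))); last first.
  by move=> g /=; rewrite andbC.
rewrite -count_filter -(permP (perm_row_gaps ik)) count_map.
apply: eq_in_count => j; rewrite mem_iota /= add0n => ji.
congr (_ < n); rewrite first_column_hooksE // /hook_length /arm /leg.
have := conjugate_gt j ik; have := count_size (fun p => j < p) kappa; lia.
Qed.

End Partitions.

(** * Boundary partitions from lowest gaps *)

Section LowestGaps.

Variables (m n : nat) (I : seq nat) (f : nat -> nat) (H : seq nat).
Hypothesis fH : lowest_gaps m I f H.

Let m0 : 0 < m. Proof. by case: fH. Qed.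
Let uI : uniq [seq f k %% m | k <- I]. Proof. by case: fH. Qed.

Lemma lowest_gaps_inj : {in I &, forall k l, f k = f l %[mod m] -> k = l}.
Proof.
move=> k l kI lI e; apply/eqP; rewrite -(nth_index 0 kI) -(nth_index 0 lI).
apply/eqP; congr nth; apply/eqP.
have s : forall k, k \in I -> index k I < size [seq f k %% m | k <- I].
  by move=> k' k'I; rewrite size_map index_mem.
rewrite -(nth_uniq 0 (s _ kI) (s _ lI) uI) !(nth_map 0) ?index_mem //.
by rewrite !nth_index // e.
Qed.

Lemma lowest_gaps_cover g : exists2 k, k \in I & f k = g %[mod m].
Proof.
have /mapP[k kI e] : g %% m \in [seq f k %% m | k <- I].
  have [_ szI _ _] := fH.
  have [] // := @uniq_min_size _ [seq f k %% m | k <- I] (iota 0 m) uI.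
  - by move=> _ /mapP[k _ ->]; rewrite mem_iota /= ltn_mod.
  - by rewrite size_map size_iota szI.
  by move=> _ ->; rewrite mem_iota /= ltn_mod.
by exists k.
Qed.

Lemma mem_lowest_gaps k h : k \in I -> f k = h %[mod m] -> (h \in H) = (h < f k).
Proof.
move=> kI e; have [_ _ _ ->] := fH; apply/hasP/idP => [[l lI]|hk].
  by case/andP=> hl /eqP e'; rewrite (lowest_gaps_inj kI lI) // e.
by exists k => //; rewrite hk e eqxx.
Qed.

Lemma perm_gaps h N : h <= N * m ->
  perm_eq [seq g <- [seq f k + i * m | i <- iota 0 N, k <- I] | g < h]
          [seq g <- iota 0 h | g \notin H].
Proof.
move=> hN; apply: uniq_perm.
- apply/filter_uniq/allpairs_uniq; first exact: iota_uniq.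
  + exact: map_uniq uI.
  move=> _ _ /allpairsP[[i k] /= [_ kI ->]] /allpairsP[[i' k'] /= [_ k'I ->]] e.
  have kk' : k = k'.
    apply: lowest_gaps_inj => //; have := congr1 (modn^~ m) e.
    by rewrite /= ![_ + _ * m]addnC !modnMDl.
  move: e; rewrite kk' => /addnI/eqP; rewrite eqn_pmul2r // => /eqP -> //.
- by rewrite filter_uniq // iota_uniq.
move=> g; rewrite !mem_filter mem_iota /= add0n andbC; apply/andP/andP.
  case=> /allpairsP[[i k] /= [_ kI ->]] gh; split=> //.
  by rewrite (mem_lowest_gaps kI) -?leqNgt ?leq_addr // addnC modnMDl.
case=> gH gh; split=> //; have [k kI e] := lowest_gaps_cover g.
move: gH; rewrite (mem_lowest_gaps kI e) -leqNgt => kg.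
have /dvdnP[i ei] : m %| g - f k by rewrite -eqn_mod_dvd // e.
apply/allpairsP; exists (i, k); rewrite /= mem_iota /= add0n; split=> //.
  by rewrite -(ltn_pmul2r m0) -ei (leq_ltn_trans (leq_subr _ _)) // (leq_trans gh).
by rewrite -ei subnKC.
Qed.

(** The gaps are enumerated as [f k + i * m], each once.  The bound on [N] makes
    the layers [i < N] reach all gaps below [h]; further layers would
    contribute nothing. *)
Lemma gaps_nearE h N : h <= N * m ->
  gaps_near n H h =
  \sum_(i < N) count (fun k => f k + i * m < h < f k + i * m + n) I.
Proof.
move=> hN; rewrite /gaps_near.
rewrite (eq_in_count (a2 := predI (fun g => h < g + n) (fun g => g \notin H))).
  2: by move=> g; rewrite mem_iota /= => gh; rewrite andbC; congr andb; lia.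
rewrite -count_filter -(permP (perm_gaps hN)) count_filter count_flatten.
rewrite sumnE !big_map -{1}(subn0 N) big_mkord.
apply: eq_bigr => i _; rewrite count_map; apply: eq_count => k /=.
by rewrite andbC.
Qed.

(** The largest element of [H] congruent to [f k] is the one a step [m] below the
    lowest gap; the class meets [H] only if [m <= f k]. *)
Lemma perm_special_hooks kappa :
  is_partition kappa -> first_column_hooks kappa =i H ->
  perm_eq [seq hook_length kappa i 0 | i <- special_rows m kappa]
          [seq f k - m | k <- I & m <= f k].
Proof.
move=> pk eH; apply: uniq_perm.
- have := uniq_first_column_hooks pk; apply: subseq_uniq.
  exact/map_subseq/filter_subseq.
- rewrite map_inj_in_uniq; first exact/filter_uniq/(map_uniq uI).
  move=> k l; rewrite !mem_filter => /andP[mk kI] /andP[ml lI] e.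
  apply: lowest_gaps_inj => //; congr (_ %% m); lia.
have hookP h : reflect (exists2 i, i < size kappa & h = hook_length kappa i 0)
    (h \in H).
  rewrite -eH; apply: (iffP mapP) => -[i]; rewrite ?mem_iota => ik ->;
    by exists i; rewrite // mem_iota.
move=> h; apply/mapP/mapP => [[i]|[k]].
  rewrite mem_filter mem_iota /= add0n => /andP[/allP spec ik] ->.
  set h' := hook_length _ _ _.
  have hH : h' \in H by apply/hookP; exists i.
  have [k kI e] := lowest_gaps_cover h'.
  have hk : h' < f k by rewrite -(mem_lowest_gaps kI e).
  have mk : h' + m <= f k.
    have : m %| f k - h' by rewrite -eqn_mod_dvd ?(ltnW hk) // e.
    by move=> /dvdn_leq; lia.
  exists k; first by rewrite mem_filter kI (leq_trans _ mk) // leq_addl.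
  have top : f k - m \in H.
    rewrite (mem_lowest_gaps kI) //; first lia.
    by rewrite -[in RHS](modnDr _ m) subnK //; lia.
  case/hookP: (top) => l lk el.
  have := spec l; rewrite mem_iota lk -el /= => /(_ isT)/implyP sl.
  have : f k - m <= h'.
    by apply: sl; rewrite -/h' -(modnDr (f k - m)) subnK ?e //; lia.
  by move: mk; lia.
rewrite mem_filter => /andP[mk kI] ->.
have e : f k = f k - m %[mod m] by rewrite -[in RHS](modnDr _ m) subnK.
have /hookP[i ik ei] : f k - m \in H by rewrite (mem_lowest_gaps kI e); lia.
exists i => //; rewrite mem_filter mem_iota /= add0n ik andbT.
apply/allP => l; rewrite mem_iota /= add0n => lk; apply/implyP => /eqP el.
have lH : hook_length kappa l 0 \in H by apply/hookP; exists l.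
have ekl : f k = hook_length kappa l 0 %[mod m] by rewrite el -ei.
move: lH; rewrite (mem_lowest_gaps kI ekl) -ei => lk'.
have : m %| f k - hook_length kappa l 0 by rewrite -eqn_mod_dvd ?(ltnW lk') // ekl.
by move=> /dvdn_leq; lia.
Qed.

(** A residue class that misses [H] has [f k < m], so that the truncated
    [f k - m] is 0 and the entry of [k] is 0: these entries are the padding of
    the boundary partition. *)
Lemma boundary_partition_gaps kappa :
  is_partition kappa -> first_column_hooks kappa =i H ->
  perm_eq (boundary_partition m n kappa) [seq gaps_near n H (f k - m) | k <- I].
Proof.
move=> pk eH; have perm := perm_special_hooks pk eH.
rewrite /boundary_partition perm_sort.
have -> : [seq boundary_in_row n kappa i | i <- special_rows m kappa] =
   [seq gaps_near n H h
      | h <- [seq hook_length kappa i 0 | i <- special_rows m kappa]].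
  rewrite -map_comp; apply/eq_in_map => i; rewrite mem_filter mem_iota /=.
  case/andP=> _ ik; rewrite boundary_in_rowE //.
  by apply: eq_count => g; rewrite eH.
have szI : size I = m by case: fH.
have -> : m - size [seq gaps_near n H h
      | h <- [seq hook_length kappa i 0 | i <- special_rows m kappa]] =
    size [seq k <- I | ~~ (m <= f k)].
  have := perm_size perm; rewrite !size_map => ->.
  by rewrite !size_filter -[X in X - _]szI
             -(count_predC (fun k => m <= f k)) addKn.
have -> : nseq (size [seq k <- I | ~~ (m <= f k)]) 0 =
   [seq gaps_near n H (f k - m) | k <- I & ~~ (m <= f k)].
  elim: (I) => //= k I' IH; case: (leqP m (f k)) => //= km.
  by rewrite IH (eqP (ltnW km)).
apply: perm_trans (perm_map _ (permEl (perm_filterC (fun k => m <= f k) I))).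
by rewrite map_cat perm_cat2r (perm_trans (perm_map _ perm)) // -map_comp.
Qed.

End LowestGaps.

(** * Steps of a lattice path *)

(** The coordinate of the [i]-th step of direction [d] that is not determined by
    [i]: the abscissa of the north step in row [i], or the height of the east
    step from abscissa [i]. *)
Fixpoint others_before (d : bool) (P : seq bool) (i : nat) : nat :=
  if P is c :: P' then
    if c == d then (if i is i'.+1 then others_before d P' i' else 0)
    else (others_before d P' i).+1
  else 0.

Definition step_start (d : bool) (P : seq bool) (i : nat) : nat * nat :=
  if d then (others_before d P i, i) else (i, others_before d P i).

(** Exchanges the two numberings of the steps of direction [d]: by their position
    in the path, as in laser crossings, and by the grid row or column they lie
    in. *)
Lemma count_steps (d : bool) (P : seq bool) (p : pred (nat * nat)) :
  count (fun k => (nth false P k == d) && p (path_point P k)) (iota 0 (size P)) =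
  count (fun i => p (step_start d P i)) (iota 0 (count_mem d P)).
Proof.
elim: P p => //= c P IH p; rewrite -[1](addn0 1) !iotaDl count_map.
pose q (z : nat * nat) := p (~~ c + z.1, c + z.2).
have -> : count (preim (addn 1)
     (fun k => (nth false (c :: P) k == d) && p (path_point (c :: P) k)))
     (iota 0 (size P)) =
   count (fun k => (nth false P k == d) && q (path_point P k)) (iota 0 (size P)).
  by apply: eq_count => k; rewrite /= add1n /q /path_point /= eqbF_neg eqb_id.
rewrite IH; have [cd|cd] := eqVneq c d.
  rewrite add1n /= -[1](addn0 1) iotaDl count_map.
  congr (_ + _); first by rewrite /path_point /step_start /= cd eqxx; case: {IH cd}d.
  apply: eq_count => i; rewrite /= add1n /q /step_start /= cd eqxx.
  by case: {IH cd}d.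
rewrite /= !add0n; apply: eq_count => i; rewrite /q /step_start /= (negbTE cd).
by case: c d {IH} cd @q => [] [].
Qed.

Lemma path_pointS P k : k < size P ->
  path_point P k.+1 =
  ((path_point P k).1 + ~~ nth false P k, (path_point P k).2 + nth false P k).
Proof.
move=> kP; rewrite /path_point (take_nth false kP) -cats1 !count_cat /= !addn0.
by rewrite eqbF_neg eqb_id.
Qed.

Lemma others_before_le d P i : others_before d P i <= count_mem (~~ d) P.
Proof.
elim: P i => //= c P' IH i; case: eqP => [->|].
  by case: i => // i; rewrite (leq_trans (IH i)) // leq_addl.
by move=> cd; have := IH i; case: c d {IH} cd => [] [].
Qed.

Lemma step_startP d P i : i < count_mem d P ->
  exists2 k, k < size P &
    [/\ nth false P k = d, path_point P k = step_start d P i &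
        path_point P k.+1 =
        ((step_start d P i).1 + ~~ d, (step_start d P i).2 + d)].
Proof.
move=> id; have := count_steps d P (pred1 (step_start d P i)).
set n := count _ (iota 0 (count_mem d P)) => e.
have : 0 < n.
  rewrite /n -has_count; apply/hasP; exists i; last exact: eqxx.
  by rewrite mem_iota.
rewrite -e -has_count => /hasP[k]; rewrite mem_iota /= add0n => kP.
case/andP=> /eqP kd /eqP kp; exists k => //; split=> //.
by rewrite path_pointS // kp kd.
Qed.

Arguments path_point : simpl never.

Lemma path_point_mono P k k' : k <= k' ->
  (path_point P k).1 <= (path_point P k').1 /\
  (path_point P k).2 <= (path_point P k').2.
Proof.
move=> kk'; rewrite /path_point /=.
have -> : take k P = take k (take k' P) by rewrite take_takel.
by split; rewrite -[X in _ <= count_mem _ X](cat_take_drop k) count_cat leq_addr.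
Qed.

Lemma path_pointsP P z : reflect (exists2 k, k <= size P & z = path_point P k)
                                 (z \in path_points P).
Proof.
apply: (iffP mapP) => -[k]; rewrite ?mem_iota => kP ->; exists k => //.
by rewrite mem_iota.
Qed.

Lemma belowP P x y :
  reflect (exists2 k, k <= size P &
             (path_point P k).1 < x /\ y < (path_point P k).2) (below P x y).
Proof.
apply: (iffP hasP) => [[z /path_pointsP[k kP ->] /andP[]]|[k kP [kx ky]]].
  by exists k.
by exists (path_point P k); [apply/path_pointsP; exists k | rewrite kx].
Qed.

(** A path point witnessing that the box is below comes after the north step of
    row [y] has been taken, hence not to the left of that step. *)
Lemma below_row P x y : y < count_mem true P ->
  below P x y = (others_before true P y < x).
Proof.
move=> yP; have [k kP [_ ek ek1]] := step_startP yP.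
apply/belowP/idP => [[k' _ [k'x yk']]|yx]; last first.
  by exists k.+1 => //; rewrite ek1 /= addn0 addn1.
have [k'k|/(path_point_mono P)[+ _]] := leqP k' k.
  have [_] := path_point_mono P k'k.
  by rewrite ek => /(leq_trans yk'); rewrite ltnn.
by rewrite ek1 /= addn0 => /leq_ltn_trans; apply.
Qed.

(** A path point witnessing that the box is below comes before the east step over
    it has been taken, hence not above that step. *)
Lemma below_column P x y : x < count_mem false P ->
  below P x.+1 y = (y < others_before false P x).
Proof.
move=> xP; have [k kP [_ ek ek1]] := step_startP xP.
apply/belowP/idP => [[k' _ [k'x yk']]|yx]; last first.
  by exists k; rewrite ?ek //= ltnW.
have [k'k|/(path_point_mono P)[+ _]] := leqP k' k.
  by have [_] := path_point_mono P k'k; rewrite ek; exact: leq_trans.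
by rewrite ek1 /= addn1 => /leq_ltn_trans/(_ k'x); rewrite ltnn.
Qed.

Lemma eqn_modMl_coprime m n x y : coprime m n ->
  m * x = m * y %[mod n] -> x = y %[mod n].
Proof.
move=> cmn; wlog xy : x y / x <= y.
  by case: (leqP x y) => [|/ltnW] xy H e; [apply: H | apply/esym/H].
move=> /esym/eqP; rewrite eqn_mod_dvd ?leq_mul2l ?xy ?orbT // -mulnBr.
rewrite Gauss_dvdr 1?coprime_sym // -eqn_mod_dvd //.
by move/eqP.
Qed.

Definition crosses_down (a b : nat) (P : seq bool) (c : nat * nat) (k : nat)
    : bool :=
  ~~ nth false P k &&
  (level a b (path_point P k.+1) < level a b c < level a b (path_point P k))%R.

(** Discrete intermediate value principle: as long as no point is on the line, the
    excess of upward over downward crossings is determined by the sides of the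
    first and the last point. *)
Lemma crossings_balance a b P c :
  (forall k, k <= size P -> level a b (path_point P k) != level a b c) ->
  forall K, K <= size P ->
  count (laser_crosses a b P c) (iota 0 K) +
    (level a b c < level a b (path_point P 0))%R =
  count (crosses_down a b P c) (iota 0 K) +
    (level a b c < level a b (path_point P K))%R.
Proof.
move=> avoid; elim=> [//|K IH] KP.
rewrite -addn1 !iotaD !count_cat add0n addn1.
have := IH (ltnW KP); have := avoid _ KP; have := avoid _ (ltnW KP).
rewrite /= /laser_crosses /crosses_down path_pointS // /level.
case: (nth false P K); case: (path_point P K) => [u v] /=; lia.
Qed.

(** * The two families of lowest gaps of a Dyck path *)

Section DyckPath.

Variables (a b : nat) (P : seq bool).
Hypotheses (a0 : 0 < a) (b0 : 0 < b) (co : coprime a b) (dP : dyck_path a b P).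

Lemma count_north : count_mem true P = a.
Proof. by case/andP: dP; rewrite /path_point take_size => /eqP[]. Qed.

Lemma count_east : count_mem false P = b.
Proof. by case/andP: dP; rewrite /path_point take_size => /eqP[]. Qed.

Lemma dyck_point k : k <= size P ->
  a * (path_point P k).1 <= b * (path_point P k).2.
Proof.
by move=> kP; case/andP: dP => _ /allP; apply; apply/path_pointsP; exists k.
Qed.

Definition north_level (y : nat) : nat := b * y - a * others_before true P y.

(** Here columns are numbered from 1, as in the southeast corner of a box: the
    step in question ends at abscissa [x], and starts at [x.-1]. *)
Definition east_level (x : nat) : nat :=
  b * others_before false P x.-1 - a * x.

(** The Dyck condition makes the truncated subtraction exact. *)
Lemma north_levelE y : y < a -> north_level y + a * others_before true P y = b * y.
Proof.
rewrite -{1}count_north => /step_startP[k kP [_ ek _]].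
by have := dyck_point (ltnW kP); rewrite ek; exact: subnK.
Qed.

Lemma east_levelE x : 0 < x <= b ->
  east_level x + a * x = b * others_before false P x.-1.
Proof.
case: x => // x; rewrite -{1}count_east => /step_startP[k kP [_ _ ek]].
by have := dyck_point kP; rewrite ek /= addn1 addn0; exact: subnK.
Qed.

Lemma positive_hooksP h :
  reflect (exists x y, [/\ 0 < x <= b, y < a, below P x y, 0 < h
                         & h + a * x = b * y])
          (h \in positive_hooks a b P).
Proof.
apply: (iffP mapP) => [[[x y]]|[x [y [xb ya bl h0 e]]]].
  rewrite mem_filter => /andP[/andP[/= bl l0]] /allpairsP[[x' y'] /=].
  rewrite !mem_iota => -[xb ya [ex ey]] ->; exists x, y.
  rewrite /level /= in l0 *; split=> //; subst x' y'; lia.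
exists (x, y); last by rewrite /level /=; lia.
rewrite mem_filter /= bl /level /=; apply/andP; split; first lia.
by apply/allpairsP; exists (x, y); rewrite !mem_iota; split=> //=; lia.
Qed.

(** The boxes of row [y] below the path are those to the right of its north step,
    and their levels are [north_level y - j * a] with [0 < j].  By coprimality the
    rows have distinct residues [b * y] mod [a].  In the converse inclusion it has
    to be checked that the box found lies in the grid and has a positive level:
    level 0 inside the grid would force [y = 0], where the lowest gap is 0 and so
    leaves no room for a hook below it. *)
Lemma lowest_gaps_north :
  lowest_gaps a (iota 0 a) north_level (positive_hooks a b P).
Proof.
have nmod y : y < a -> north_level y = b * y %[mod a].
  by move=> ya; rewrite -(north_levelE ya) addnC mulnC modnMDl.
split; rewrite ?size_iota //.
- rewrite map_inj_in_uniq ?iota_uniq // => x y; rewrite !mem_iota /= => xa ya.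
  rewrite !nmod // => /(eqn_modMl_coprime _); rewrite coprime_sym => /(_ co).
  by rewrite !modn_small.
move=> h; apply/positive_hooksP/hasP => [[x [y [xb ya bl h0 e]]]|[y]].
  exists y; first by rewrite mem_iota.
  move: bl; rewrite below_row ?count_north // => yx.
  have ne := north_levelE ya; apply/andP; split.
    by rewrite -(ltn_pmul2l a0) in yx; lia.
  by rewrite nmod // -e addnC mulnC modnMDl.
rewrite mem_iota /= => ya /andP[hf].
rewrite eq_sym eqn_mod_dvd ?(ltnW hf) // => /dvdnP[j ej].
have ne := north_levelE ya.
have e : h + a * (others_before true P y + j) = b * y by lia.
have j0 : 0 < j by case: j ej {e} => //; lia.
have h0 : 0 < h.
  rewrite lt0n; apply: contraTneq hf => h0.
  have : a %| b * y by rewrite -e h0 add0n dvdn_mulr.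
  rewrite Gauss_dvdr // /dvdn modn_small // => /eqP y0.
  by rewrite /north_level y0 muln0.
exists (others_before true P y + j), y; split=> //.
  apply/andP; split; first lia.
  rewrite leqNgt; apply/negP => bx.
  have : b * y < b * a by rewrite ltn_pmul2l.
  have : a * b <= a * (others_before true P y + j) by rewrite leq_pmul2l // ltnW.
  lia.
by rewrite below_row ?count_north //; lia.
Qed.

(** The transposed statement: the boxes of column [x] below the path are those
    under its east step, with levels [east_level x - j * b] and [0 < j].  Level 0
    could occur only for the corner [(b, a)], which is not the southeast corner of
    a box of the grid. *)
Lemma lowest_gaps_east :
  lowest_gaps b (iota 1 b) east_level (positive_hooks a b P).
Proof.
have emod x : 0 < x <= b -> east_level x + a * x = 0 %[mod b].
  by move=> xb; rewrite east_levelE // mulnC modnMl mod0n.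
split; rewrite ?size_iota //.
- rewrite map_inj_in_uniq ?iota_uniq // => x y.
  rewrite !mem_iota !add1n !ltnS => xb yb e.
  have : a * x = a * y %[mod b].
    apply/eqP; rewrite -(eqn_modDl (east_level x)) emod //.
    by rewrite -modnDml e modnDml emod.
  move/(eqn_modMl_coprime co).
  have small z : 0 < z <= b -> z %% b = if z == b then 0 else z.
    case: eqP => [-> _|zb zlt]; first exact: modnn.
    by rewrite modn_small //; lia.
  by rewrite !small //; do 2!case: eqP; lia.
move=> h; apply/positive_hooksP/hasP => [[x [y [xb ya bl h0 e]]]|[x]].
  exists x; first by rewrite mem_iota; lia.
  have x0 : 0 < x by case/andP: xb.
  move: bl; rewrite -{1}(prednK x0) below_column ?count_east => [yx|]; last lia.
  have ee := east_levelE xb; apply/andP; split.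
    by rewrite -(ltn_pmul2l b0) in yx; lia.
  by rewrite -(eqn_modDr (a * x)) e ee ![b * _]mulnC !modnMl.
rewrite mem_iota add1n ltnS => xb /andP[hf].
rewrite eq_sym eqn_mod_dvd ?(ltnW hf) // => /dvdnP[j ej].
have ee := east_levelE xb.
have j0 : 0 < j by case: j ej => //; lia.
set Y := others_before false P x.-1 in ee.
have Ya : Y <= a by rewrite -count_north; exact: others_before_le.
have jY : j <= Y by rewrite -(leq_pmul2l b0); lia.
have e : h + a * x = b * (Y - j) by rewrite mulnBr; lia.
have h0 : 0 < h.
  rewrite lt0n; apply/eqP => h0.
  have : b %| a * x by rewrite -[a * x]add0n -h0 e dvdn_mulr.
  rewrite Gauss_dvdr 1?coprime_sym // => /dvdn_leq bx.
  have {bx} xe : x = b by lia.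
  move: e; rewrite h0 add0n xe mulnC => /eqP; rewrite eqn_pmul2l // => /eqP; lia.
exists x, (Y - j); split=> //; first lia.
have x0 : 0 < x by case/andP: xb.
rewrite -(prednK x0) below_column ?count_east; [rewrite -/Y|]; lia.
Qed.

(** Grid points of equal level differ by a multiple of [(b, a)], so a path point on
    the laser would have to be the southeast corner of the box itself.  But a box
    below the path has its southeast corner strictly on the far side of a path
    point, which contradicts monotonicity. *)
Lemma laser_avoids_path x y k :
  0 < x <= b -> y < a -> below P x y -> k <= size P ->
  level a b (path_point P k) != level a b (x, y).
Proof.
move=> xb ya /belowP[k1 _ [k1x yk1]] kP; apply/eqP.
have endP : path_point P (size P) = (b, a) by case/andP: dP => /eqP.
have := path_point_mono P kP; rewrite endP.
case e : (path_point P k) => [u v] /= [ub va].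
rewrite /level /= => lv.
have {}lv : b * v + a * x = b * y + a * u by lia.
have : u = x %[mod b].
  apply: (eqn_modMl_coprime co); have := congr1 (modn^~ b) lv => /=.
  by rewrite ![b * _]mulnC !modnMDl => ->.
have [ux|xu|ux] := ltngtP u x.
- move/esym/eqP; rewrite eqn_mod_dvd ?(ltnW ux) // => /dvdn_leq bx.
  (* The path point would lie at height [y - a], which is negative. *)
  have [u0 xe] : u = 0 /\ x = b by lia.
  move: lv; rewrite u0 xe; nia.
- move/eqP; rewrite eqn_mod_dvd ?(ltnW xu) // => /dvdn_leq; lia.
move=> _; have vy : v = y by apply/eqP; rewrite -(eqn_pmul2l b0); lia.
have [k1k|kk1] := leqP k k1.
  have [+ _] := path_point_mono P k1k.
  by rewrite e => /leq_ltn_trans/(_ k1x); rewrite ux ltnn.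
have [_] := path_point_mono P (ltnW kk1).
by rewrite e vy => /(leq_trans yk1); rewrite ltnn.
Qed.

End DyckPath.

(** * Laser sums *)

Section LaserSums.

Variables (a b : nat) (P : seq bool).
Hypotheses (a0 : 0 < a) (b0 : 0 < b) (co : coprime a b) (dP : dyck_path a b P).

Let f := north_level a b P.
Let e := east_level a b P.
Let H := positive_hooks a b P.

(** Along a north step the level rises by [b]. *)
Lemma laser_north x y h : h + a * x = b * y ->
  count (laser_crosses a b P (x, y)) (iota 0 (size P)) =
  count (fun k => f k < h < f k + b) (iota 0 a).
Proof.
move=> hE.
pose p z := (level a b z < level a b (x, y) < level a b z + b%:Z)%R.
transitivity (count (fun k => (nth false P k == true) && p (path_point P k))
                    (iota 0 (size P))).
  apply: eq_in_count => k; rewrite mem_iota /= add0n => kP.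
  rewrite /laser_crosses eqb_id /p; case: (boolP (nth false P k)) => //= nk.
  rewrite path_pointS // nk /level /=; congr (_ && _); lia.
rewrite count_steps (count_north dP); apply: eq_in_count => k.
rewrite mem_iota add0n => ka; have := north_levelE dP ka; rewrite -/f.
rewrite /p /level /=; lia.
Qed.

(** The filling is defined through north steps; the balance of crossings turns it
    into a count of east steps, along each of which the level falls by [a]. *)
Lemma laser_east x y h : 0 < x <= b -> y < a -> below P x y -> 0 < h ->
  h + a * x = b * y ->
  count (laser_crosses a b P (x, y)) (iota 0 (size P)) =
  count (fun k => e k < h < e k + a) (iota 1 b).
Proof.
move=> xb ya bl h0 hE.
have /(_ (size P) (leqnn _)) := @crossings_balance a b P (x, y)
  (fun k => laser_avoids_path a0 b0 co dP xb ya bl).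
have -> : path_point P (size P) = (b, a) by case/andP: dP => /eqP.
have -> : (level a b (x, y) < level a b (path_point P 0))%R = false.
  by rewrite /level /path_point take0 /=; lia.
have -> : (level a b (x, y) < level a b (b, a))%R = false.
  by rewrite /level /=; lia.
rewrite !addn0 => ->.
pose p z := (level a b z - a%:Z < level a b (x, y) < level a b z)%R.
transitivity (count (fun k => (nth false P k == false) && p (path_point P k))
                    (iota 0 (size P))).
  apply: eq_in_count => k; rewrite mem_iota /= add0n => kP.
  rewrite /crosses_down eqbF_neg /p; case: (boolP (nth false P k)) => //= nk.
  rewrite path_pointS // (negbTE nk) /level /=; congr (_ && _); lia.
rewrite count_steps (count_east dP) -[1](addn0 1) iotaDl count_map.
apply: eq_in_count => k; rewrite mem_iota add0n => kb.
have := @east_levelE a b P dP k.+1; rewrite -/e => /(_ kb).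
rewrite /= add1n /p /level /=; lia.
Qed.

(** The box at distance [i] from the leftmost box of row [y] below the path
    contributes the gaps [f k + i * a] of layer [i]. *)
Lemma laser_row_sum y : y < a ->
  \sum_(1 <= x < b.+1) laser_filling a b P x y = gaps_near b H (f y - a).
Proof.
move=> ya; have fE := north_levelE dP ya; rewrite -/f in fE.
set X := others_before true P y in fE.
have Xb : X <= b by rewrite -(count_east dP); exact: others_before_le.
rewrite (gaps_nearE b (lowest_gaps_north a0 b0 co dP) (N := b - X)); last first.
  have : b * y < b * a by rewrite ltn_pmul2l.
  by rewrite mulnBl -/f; have := leq_mul2r a X b; rewrite Xb orbT; lia.
rewrite (@big_cat_nat _ _ _ X.+1) //=.
rewrite big1_seq ?add0n; last first.
  move=> x; rewrite mem_index_iota ltnS => /and3P[_ _ xX]; rewrite /laser_filling.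
  by rewrite below_row ?(count_north dP) // ltnNge xX.
rewrite -{1}[X.+1]add0n big_addn subSS big_mkord; apply: eq_bigr => i _.
rewrite /laser_filling below_row ?(count_north dP) // -/X.
have -> : X < i + X.+1 by lia.
rewrite /= /level /=; case: ifP => lp.
  rewrite (@laser_north _ _ (f y - a - i * a)); last by lia.
  by apply: eq_count => k /=; rewrite -/f; lia.
(* A box on or under the diagonal carries no filling, and its layer starts too
   high to have a gap below [f y - a]. *)
apply/esym/eqP; rewrite -leqn0 leqNgt -has_count; apply/hasPn => k _.
rewrite -/f; lia.
Qed.

(** The layer [i] of the gaps is now contributed by the box at depth [i] under the
    topmost box of column [x] below the path. *)
Lemma laser_column_sum x : 0 < x <= b ->
  \sum_(0 <= y < a) laser_filling a b P x y = gaps_near a H (e x - b).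
Proof.
move=> xb; have eE := east_levelE dP xb; rewrite -/e in eE.
have x0 : 0 < x by case/andP: xb.
set Y := others_before false P x.-1 in eE.
have Ya : Y <= a by rewrite -(count_north dP); exact: others_before_le.
have bl y : below P x y = (y < Y).
  by rewrite -{1}(prednK x0) below_column ?(count_east dP) //; lia.
rewrite (gaps_nearE a (lowest_gaps_east a0 b0 co dP) (N := Y)); last first.
  by rewrite -/e; lia.
rewrite (@big_cat_nat _ _ _ Y) //=.
rewrite [X in _ + X]big1_seq ?addn0; last first.
  move=> y; rewrite mem_index_iota /laser_filling bl => /and3P[_ Yy _].
  by rewrite ltnNge Yy.
rewrite big_mkord (reindex_inj rev_ord_inj) /=; apply: eq_bigr => i _.
have iY := ltn_ord i; rewrite /laser_filling bl.
have -> : Y - i.+1 < Y by lia.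
have lE : b * (Y - i.+1) + b + i * b = b * Y by nia.
rewrite /= /level /=; case: ifP => lp.
  rewrite (@laser_east _ _ (e x - b - i * b)) ?bl //; [|lia..].
  by apply: eq_count => k /=; rewrite -/e; lia.
apply/esym/eqP; rewrite -leqn0 leqNgt -has_count; apply/hasPn => k _.
rewrite -/e; lia.
Qed.

End LaserSums.

Theorem theorem5p15 (a b : nat) (P : seq bool)
    (ha : 0 < a) (hb : 0 < b) (hab : coprime a b) (hP : dyck_path a b P) :
  perm_eq (lambda_partition a b P)
    [seq \sum_(1 <= x < b.+1) laser_filling a b P x y | y <- iota 0 a]
  /\
  perm_eq (mu_partition a b P)
    [seq \sum_(0 <= y < a) laser_filling a b P x y | x <- iota 1 b].
Proof.
have [pk hooks] := core_of_pathP a b P; split.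
  have -> : [seq \sum_(1 <= x < b.+1) laser_filling a b P x y | y <- iota 0 a] =
     [seq gaps_near b (positive_hooks a b P) (north_level a b P y - a)
        | y <- iota 0 a].
    apply/eq_in_map => y; rewrite mem_iota => ya.
    exact: laser_row_sum.
  rewrite /lambda_partition.
  exact (boundary_partition_gaps b (lowest_gaps_north ha hb hab hP) pk hooks).
have -> : [seq \sum_(0 <= y < a) laser_filling a b P x y | x <- iota 1 b] =
   [seq gaps_near a (positive_hooks a b P) (east_level a b P x - b)
      | x <- iota 1 b].
  apply/eq_in_map => x; rewrite mem_iota add1n ltnS => xb.
  exact: laser_column_sum.
rewrite /mu_partition.
exact (boundary_partition_gaps a (lowest_gaps_east ha hb hab hP) pk hooks).
Qed.
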